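(* Let $\vdash$ be a logic that is not graph-based. If there are two distinct formulas $\varphi$ and $\psi$ that are logically equivalent in $\vdash$ and satisfy $\mathrm{Var}(\varphi) \cup \mathrm{Var}(\psi) = \{ x \}$ for some variable $x$, then $\vdash$ has an algebraic semantics.
   Context: An algebraic language $\mathscr{L}$ is a set of connectives (function symbols) with finite arities; constants are $0$-ary connectives. $Fm$ denotes the set of $\mathscr{L}$-formulas built from a denumerable set $\mathrm{Var}$ of variables, and $\boldsymbol{Fm}$ the corresponding absolutely free algebra. A logic $\vdash$ is a (Tarskian) consequence relation on $Fm$, for some language $\mathscr{L}_{\vdash}$, that is substitution invariant: $\Gamma \vdash \varphi$ implies $\sigma[\Gamma] \vdash \sigma(\varphi)$ for every endomorphism $\sigma$ of $\boldsymbol{Fm}$. $\Gamma \dashv\vdash \Delta$ means $\Gamma \vdash \delta$ for all $\delta\in\Delta$ and $\Delta \vdash \gamma$ for all $\gamma \in \Gamma$. $\mathrm{Var}(\varphi)$ is the set of variables occurring in $\varphi$. Two formulas $\varphi,\psi$ are logically equivalent in $\vdash$ if $\delta(\varphi,\vec{z}) \dashv\vdash \delta(\psi,\vec{z})$ for every formula $\delta(v,\vec{z})$. A language (or a logic formulated in it) is graph-based if all its connectives have arity at most $1$ and it has at most one unary connective. For a set of equations $\boldsymbol{\tau}(x)$ in one variable $x$, $\boldsymbol{\tau}(\varphi)$ is the set of equations obtained by substituting $\varphi$ for $x$, and $\boldsymbol{\tau}[\Gamma] = \bigcup_{\gamma\in\Gamma}\boldsymbol{\tau}(\gamma)$. For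 a class $\mathsf{K}$ of algebras, $\Theta \vDash_{\mathsf{K}} \epsilon \approx \delta$ means that for every $\boldsymbol{A} \in \mathsf{K}$ and homomorphism $h\colon \boldsymbol{Fm}\to\boldsymbol{A}$, if $h(\varphi)=h(\psi)$ for all $\varphi\approx\psi\in\Theta$ then $h(\epsilon)=h(\delta)$. A logic $\vdash$ has an algebraic semantics if there are a set of equations $\boldsymbol{\tau}(x)$ and a class $\mathsf{K}$ of $\mathscr{L}_\vdash$-algebras such that for all $\Gamma\cup\{\varphi\}\subseteq Fm$: $\Gamma\vdash\varphi$ iff $\boldsymbol{\tau}[\Gamma]\vDash_{\mathsf{K}}\boldsymbol{\tau}(\varphi)$ (then $\mathsf{K}$ is a $\boldsymbol{\tau}$-algebraic semantics). *)

(* Defs.v *)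
From mathcomp Require Import all_boot.
From mathcomp Require Import boolp classical_sets.

Set Implicit Arguments.
Unset Strict Implicit.
Unset Printing Implicit Defensive.

Local Open Scope classical_set_scope.

Record language := Language {
  conn : Type;
  arity : conn -> nat
}.

Record algebra (L : language) := Algebra {
  carrier :> Type;
  op : forall c : conn L, ('I_(arity c) -> carrier) -> carrier
}.

Definition is_hom (L : language) (A B : algebra L) (h : A -> B) : Prop :=
  forall (c : conn L) (a : 'I_(arity c) -> A),
    h (op (c := c) a) = op (c := c) (fun i => h (a i)).

Definition var : Type := nat.

Inductive formula (L : language) : Type :=
  | FVar of var
  | FApp (c : conn L) of 'I_(arity c) -> formula L.

Definition Fm (L : language) : algebra L := Algebra (@FApp L).

Fixpoint Var (L : language) (f : formula L) : set var :=
  match f with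
  | FVar y => [set y]
  | FApp c a => [set y | exists i : 'I_(arity c), Var (a i) y]
  end.

(* [replace v f d] is d(f, z), where d = d(v, z): every occurrence of v in d
   becomes f, and all other variables are left unchanged. *)
Fixpoint replace (L : language) (v : var) (f d : formula L) : formula L :=
  match d with
  | FVar y => if y == v then f else FVar L y
  | FApp c a => FApp (fun i => replace v f (a i))
  end.

(* Monotonicity follows from [entails_refl] and [entails_cut]. Finitarity is
   not required. *)
Record logic (L : language) := Logic {
  entails : set (Fm L) -> Fm L -> Prop;
  entails_refl : forall (G : set (Fm L)) (f : Fm L), G f -> entails G f;
  entails_cut : forall (G D : set (Fm L)) (f : Fm L),
    (forall g, D g -> entails G g) -> entails D f -> entails G f;
  entails_subst : forall (s : Fm L -> Fm L) (G : set (Fm L)) (f : Fm L),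
    is_hom s -> entails G f -> entails (s @` G) (s f)
}.

Definition interderivable (L : language) (l : logic L) (G D : set (Fm L)) :
    Prop :=
  (forall d, D d -> entails l G d) /\ (forall g, G g -> entails l D g).

Definition logically_equivalent (L : language) (l : logic L) (f g : Fm L) :
    Prop :=
  forall (d : Fm L) (v : var),
    interderivable l [set replace v f d] [set replace v g d].

Definition graph_based (L : language) : Prop :=
  (forall c : conn L, arity c <= 1) /\
  (forall c d : conn L, arity c = 1 -> arity d = 1 -> c = d).

Definition equation (L : language) : Type := (Fm L * Fm L)%type.

Definition equations_in (L : language) (x : var) (tau : set (equation L)) :
    Prop :=
  forall e, tau e -> Var e.1 `|` Var e.2 `<=` [set x].

Definition eqs_at (L : language) (x : var) (tau : set (equation L))
    (f : Fm L) : set (equation L) :=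
  [set (replace x f e.1, replace x f e.2) | e in tau].

Definition eqs_image (L : language) (x : var) (tau : set (equation L))
    (G : set (Fm L)) : set (equation L) :=
  \bigcup_(g in G) eqs_at x tau g.

Definition eq_entails (L : language) (K : algebra L -> Prop)
    (Th : set (equation L)) (e : equation L) : Prop :=
  forall (A : algebra L) (h : Fm L -> A), K A -> is_hom h ->
    (forall t, Th t -> h t.1 = h t.2) -> h e.1 = h e.2.

Definition algebraic_semantics (L : language) (l : logic L) (x : var)
    (tau : set (equation L)) (K : algebra L -> Prop) : Prop :=
  forall (G : set (Fm L)) (f : Fm L),
    entails l G f <->
    (forall e, eqs_at x tau f e -> eq_entails K (eqs_image x tau G) e).

Definition has_algebraic_semantics (L : language) (l : logic L) : Prop :=
  exists (x : var) (tau : set (equation L)) (K : algebra L -> Prop),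
    equations_in x tau /\ algebraic_semantics l x tau K.

(* Main.v *)
Require Import Defs.
From mathcomp Require Import all_boot zify.
From mathcomp Require Import boolp classical_sets.

Set Implicit Arguments.
Unset Strict Implicit.
Unset Printing Implicit Defensive.

Local Open Scope classical_set_scope.

(** Plug [phi] and [psi] into one context, obtaining one-variable formulas
    [eps] and [delta] that are still logically equivalent. The context is chosen
    so that [eps] and [delta] have no common instance, and no instance of
    [delta] is an instance of a proper non-variable subformula of [eps] or
    [delta]; if the language is not graph-based, there is room for this. For a
    theory [T], let the operations of the term algebra return [eps(f)] whenever
    they would return [delta(f)] with [f] in [T]. A valuation in this algebra
    satisfies [eps(f) = delta(f)] exactly when the value of [f] lies in [T].
    As formulas were only exchanged for logically equivalent ones, this value is
    logically equivalent to the result of applying the valuation to [f] as a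
    substitution. So the solution sets of [eps = delta] are the preimages of
    theories under substitutions, that is, the theories. *)

(** * Formulas and substitutions *)

Canonical Fm.

Section Formulas.
Variable L : language.
Implicit Types (x y z : var) (f g t u : formula L) (c : conn L).

Lemma FApp_inj_conn c c' (a : 'I_(arity c) -> formula L)
    (b : 'I_(arity c') -> formula L) : FApp a = FApp b -> c = c'.
Proof. by case. Qed.

Lemma FApp_inj_args c (a b : 'I_(arity c) -> formula L) :
  FApp a = FApp b -> a =1 b.
Proof.
pose arg n t := if t is FApp c' a' then omap a' (insub n) else None.
by move=> ab i; have := congr1 (arg i) ab; rewrite /arg !valK => -[].
Qed.

Lemma Var_arg c (a : 'I_(arity c) -> formula L) i :
  Var (a i) `<=` Var (FApp a).
Proof. by move=> z; exists i. Qed.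

Lemma Var_arg_subset c (a : 'I_(arity c) -> formula L) i (A : set var) :
  Var (FApp a) `<=` A -> Var (a i) `<=` A.
Proof. exact: subset_trans (@Var_arg _ a i). Qed.

Fixpoint var_bound t : nat :=
  match t with
  | FVar y => y.+1
  | FApp c a => \max_(i < arity c) var_bound (a i)
  end.

Lemma Var_lt_bound t z : Var t z -> z < var_bound t.
Proof.
elim: t => [y ->|c a IH [i /IH lt_z]] //.
exact: leq_trans lt_z (leq_bigmax (F := fun j => var_bound (a j)) i).
Qed.

Fixpoint depth t : nat :=
  match t with
  | FVar _ => 0
  | FApp c a => (\max_(i < arity c) depth (a i)).+1
  end.

Lemma depth_arg c (a : 'I_(arity c) -> formula L) i :
  depth (a i) < depth (FApp a).
Proof. by rewrite /= ltnS; apply: (leq_bigmax (F := fun j => depth (a j))). Qed.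

Fixpoint eval (A : algebra L) (v : var -> A) t : A :=
  match t with
  | FVar y => v y
  | FApp c a => op (fun i => eval v (a i))
  end.

Lemma eval_is_hom (A : algebra L) (v : var -> A) : is_hom (eval v : Fm L -> A).
Proof. by []. Qed.

Lemma hom_eval (A : algebra L) (h : Fm L -> A) t :
  is_hom h -> h t = eval (h \o FVar L) t.
Proof.
move=> hom_h; elim: t => //= c a IH; rewrite [LHS]hom_h.
by congr (op _); apply/funext.
Qed.

Lemma eq_in_eval (A : algebra L) (v w : var -> A) t :
  (forall z, Var t z -> v z = w z) -> eval v t = eval w t.
Proof.
elim: t => [y|c a IH] /= vw; first exact: vw.
by congr (op _); apply/funext => i; apply: IH => z za; apply: vw; exists i.
Qed.

End Formulas.

Local Notation subst := (@eval _ (Fm _)).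

Section Substitution.
Variable L : language.
Implicit Types (x y z : var) (f g t u : formula L) (c : conn L).

Lemma subst_FVar t : subst (FVar L) t = t.
Proof. by elim: t => //= c a IH; congr FApp; apply/funext. Qed.

Lemma eval_subst (A : algebra L) (v : var -> A) (s : var -> formula L) t :
  eval v (subst s t) = eval (eval v \o s) t.
Proof. by elim: t => //= c a IH; congr (op _); apply/funext. Qed.

Lemma replaceE x f t :
  replace x f t = subst (fun y => if y == x then f else FVar L y) t.
Proof. by elim: t => //= c a IH; congr FApp; apply/funext. Qed.

Lemma replace_replace x f g t :
  replace x f (replace x g t) = replace x (replace x f g) t.
Proof.
rewrite [RHS]replaceE (replaceE x g) replaceE eval_subst.
by apply: eq_in_eval => y _ /=; case: ifP => /=; rewrite ?replaceE // => ->.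
Qed.

Lemma replace_notin x f t : ~ Var t x -> replace x f t = t.
Proof.
move=> xt; rewrite replaceE -[RHS]subst_FVar; apply: eq_in_eval => z.
by case: eqP => // ->.
Qed.

Lemma replace_inj x t : Var t x -> injective (fun f => replace x f t).
Proof.
move=> + f g; elim: t => [y|c a IH] /=; first by move=> <-; rewrite eqxx.
by move=> [i xa] /FApp_inj_args /(_ i); apply: IH.
Qed.

Lemma replaceC_fresh x y f g t : ~ Var t y ->
  replace y f (replace x g t) = replace x (replace y f g) t.
Proof.
elim: t => [z|c a IH] /= yt; first by do 2![case: eqP => //=] => zy; case: yt.
by congr FApp; apply/funext => i; apply: IH => ya; apply: yt; exists i.
Qed.

Lemma Var_replace_subset x f t (A : set var) :
  Var t `<=` A -> Var f `<=` A -> Var (replace x f t) `<=` A.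
Proof.
move=> + fA; elim: t => [y|c a IH] /= tA; first by case: eqP.
by move=> z /= [i]; apply: IH => w ?; apply: tA; exists i.
Qed.

Lemma Var_replace_superset x f t : Var t x -> Var f `<=` Var (replace x f t).
Proof.
elim: t => [y|c a IH] /=; first by move=> <-; rewrite eqxx.
by move=> [i /IH sub_a] z /sub_a ?; exists i.
Qed.

Lemma depth_replace_ub x f t : depth (replace x f t) <= depth f + depth t.
Proof.
elim: t => [y|c a IH]; first by rewrite /=; case: eqP => //=; lia.
rewrite /= addnS ltnS; apply/bigmax_leqP => i _.
by have := depth_arg a i; have := IH i; rewrite /=; lia.
Qed.

Lemma depth_replace_lb x f t : Var t x -> depth f <= depth (replace x f t).
Proof.
elim: t => [y|c a IH] /=; first by move=> <-; rewrite eqxx.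
move=> [i /IH le_i]; apply: leq_trans le_i _.
exact/ltnW/(depth_arg (fun i => replace x f (a i))).
Qed.

End Substitution.

(** * Logical equivalence and theories *)

Section LogicalEquivalence.
Variables (L : language) (l : logic L).
Implicit Types (f g t u : formula L) (s : var -> formula L).

Lemma entails1_trans f g t :
  entails l [set f] g -> entails l [set g] t -> entails l [set f] t.
Proof. by move=> fg; apply: entails_cut => _ ->. Qed.

Lemma entails1_subst s f g : entails l [set f] g ->
  entails l [set subst s f] (subst s g).
Proof. by move=> /(entails_subst (@eval_is_hom _ _ s)); rewrite image_set1. Qed.

Lemma logically_equivalent_refl f : logically_equivalent l f f.
Proof. by move=> d v; split=> _ ->; apply: entails_refl. Qed.

Lemma logically_equivalent_sym f g :
  logically_equivalent l f g -> logically_equivalent l g f.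
Proof. by move=> fg d v; have [? ?] := fg d v. Qed.

Lemma logically_equivalent_trans f g t :
  logically_equivalent l f g -> logically_equivalent l g t ->
  logically_equivalent l f t.
Proof.
move=> fg gt d v; have [fg_d gf_d] := fg d v; have [gt_d tg_d] := gt d v.
split=> _ ->; first exact: entails1_trans (fg_d _ erefl) (gt_d _ erefl).
exact: entails1_trans (tg_d _ erefl) (gf_d _ erefl).
Qed.

(* Renaming the variables of the context [d] apart from those of [f] and [g]
   makes [d(subst s f)] a substitution instance of a context applied to [f]. *)
Lemma logically_equivalent_subst s f g :
  logically_equivalent l f g ->
  logically_equivalent l (subst s f) (subst s g).
Proof.
move=> fg d v; pose n := maxn (var_bound f) (var_bound g).
pose s' z := if z < n then s z else FVar L (z - n).
pose d' := subst (fun z => FVar L (n + z)) d.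
have s'E t : var_bound t <= n ->
    subst s' (replace (n + v) t d') = replace v (subst s t) d.
  move=> tn; rewrite !replaceE !eval_subst.
  apply: eq_in_eval => y _ /=; rewrite eqn_add2l.
  case: ifP => _ /=; last by rewrite /s' ltnNge leq_addr /= addKn.
  apply: eq_in_eval => z /Var_lt_bound zt.
  by rewrite /s' (leq_trans zt tn).
rewrite -!s'E ?leq_maxl ?leq_maxr //; have [fg_d gf_d] := fg d' (n + v).
by split=> _ ->; apply: entails1_subst; [apply: fg_d|apply: gf_d].
Qed.

Lemma logically_equivalent_replace x f t u :
  logically_equivalent l t u ->
  logically_equivalent l (replace x f t) (replace x f u).
Proof. by rewrite !replaceE; apply: logically_equivalent_subst. Qed.

Lemma logically_equivalent_update (c : conn L) (a : 'I_(arity c) -> formula L)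
    (i : 'I_(arity c)) t u :
  logically_equivalent l t u ->
  logically_equivalent l
    (FApp [eta a with i |-> t]) (FApp [eta a with i |-> u]).
Proof.
move=> tu d v; pose w := maxn (var_bound d) (var_bound (FApp a)).
have fresh e : var_bound e <= w -> ~ Var e w.
  by move=> ew /Var_lt_bound; rewrite ltnNge ew.
have extend_d f : replace v (FApp [eta a with i |-> f]) d =
    replace w f (replace v (FApp [eta a with i |-> FVar L w]) d).
  rewrite replaceC_fresh; last by apply: fresh; apply: leq_maxl.
  congr (replace _ _ _) => /=; congr FApp; apply/funext => j /=.
  case: eqP => /= [_|_]; first by rewrite eqxx.
  rewrite replace_notin // => /(@Var_arg _ _ a).
  by apply: fresh; apply: leq_maxr.
by rewrite (extend_d t) (extend_d u); apply: tu.
Qed.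

Lemma logically_equivalent_app (c : conn L) (a b : 'I_(arity c) -> formula L) :
  (forall i, logically_equivalent l (a i) (b i)) ->
  logically_equivalent l (FApp a) (FApp b).
Proof.
move=> ab; pose mix k (i : 'I_(arity c)) := if i < k then b i else a i.
suff mixP k : k <= arity c -> logically_equivalent l (FApp a) (FApp (mix k)).
  rewrite (_ : b = mix (arity c)); first exact: mixP.
  by apply/funext => i; rewrite /mix ltn_ord.
elim: k => [|k IH] kn.
  by rewrite (_ : mix 0 = a); [apply: logically_equivalent_refl|apply/funext].
apply: logically_equivalent_trans (IH (ltnW kn)) _.
pose i := Ordinal kn.
rewrite (_ : mix k = [eta mix k with i |-> a i]); last first.
  by apply/funext => j /=; case: eqP => // ->; rewrite /mix ltnn.
rewrite (_ : mix k.+1 = [eta mix k with i |-> b i]).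
  exact: logically_equivalent_update.
apply/funext => j /=; rewrite /mix ltnS leq_eqVlt -val_eqE /=.
by case: eqP => //= jk; congr b; apply/val_inj.
Qed.

Definition is_theory (T : set (Fm L)) : Prop := forall f, entails l T f -> T f.

Lemma consequences_theory (G : set (Fm L)) : is_theory [set f | entails l G f].
Proof. by move=> f /=; apply: entails_cut. Qed.

Lemma preimage_subst_theory s (T : set (Fm L)) :
  is_theory T -> is_theory (subst s @^-1` T).
Proof.
move=> thT f /(entails_subst (@eval_is_hom _ _ s)) Tf.
by apply/thT/(entails_cut _ Tf) => _ [g Tg <-]; apply: entails_refl.
Qed.

Lemma logically_equivalent_theory (T : set (Fm L)) f g :
  is_theory T -> logically_equivalent l f g -> T f <-> T g.
Proof.
move=> thT /(_ (FVar L 0) 0) /= [fg gf].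
have closed t u : entails l [set t] u -> T t -> T u.
  by move=> tu Tt; apply/thT/(entails_cut _ tu) => _ ->; apply: entails_refl.
by split; apply: closed; [apply: fg|apply: gf].
Qed.

End LogicalEquivalence.

Section Semantics.
Variables (L : language) (l : logic L) (x : var).

Definition solutions (tau : set (equation L)) (A : algebra L) (h : Fm L -> A) :
    set (Fm L) :=
  [set f | forall e, eqs_at x tau f e -> h e.1 = h e.2].

Lemma algebraic_semantics_theories (tau : set (equation L))
    (K : algebra L -> Prop) :
  (forall A, K A -> forall h : Fm L -> A, is_hom h ->
     is_theory l (solutions tau h)) ->
  (forall T, is_theory l T -> exists A : algebra L, exists2 h : Fm L -> A,
     K A /\ is_hom h & solutions tau h = T) ->
  algebraic_semantics l x tau K.
Proof.
move=> sound complete G f; split=> [Gf e tau_e A h KA hom_h solG|sem].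
  apply: (sound A KA h hom_h f) tau_e; apply: entails_cut Gf => g Gg.
  by apply: entails_refl => e' tau_e'; apply: solG; exists g.
have [A [h [KA hom_h] sol_h]] := complete _ (@consequences_theory _ l G).
suff : solutions tau h f by rewrite sol_h.
move=> e /sem; apply=> // t [g Gg]; apply: (_ : solutions tau h g).
by rewrite sol_h; apply: entails_refl.
Qed.

End Semantics.

(** * Redirected term algebras *)

Section SubformulaInstances.
Variables (L : language) (Q : set (formula L)) (x : var).
Implicit Types (f g t : formula L).

Fixpoint subinstances_in t : Prop :=
  match t with
  | FVar _ => True
  | FApp c a =>
      (forall f, Q (replace x f t)) /\ (forall i, subinstances_in (a i))
  end.

Definition proper_subinstances_in t : Prop :=
  if t is FApp c a then forall i, subinstances_in (a i) else False.

Lemma subinstances_in_replace (k : nat) g t :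
  (forall f s, 0 < depth s < k -> Q (replace x (replace x f g) s)) ->
  subinstances_in g -> depth t < k -> subinstances_in (replace x g t).
Proof.
move=> Q_shallow Qg; elim: t => [y|c a IH] tk; first by rewrite /=; case: ifP.
split=> [f|i]; last exact/IH/(ltn_trans (depth_arg a i)).
rewrite -/(replace x g (FApp a)) replace_replace.
exact: Q_shallow.
Qed.

End SubformulaInstances.

Section RedirectedAlgebra.
Variables (L : language) (l : logic L) (x : var) (eps delta : formula L).
Variable Q : set (formula L).
Hypothesis eps_equiv_delta : logically_equivalent l eps delta.
Hypothesis delta_x : Var delta x.
Implicit Types (T : set (formula L)) (f t : formula L) (v : var -> formula L).

Definition redirect T t : formula L :=
  if pselect (exists2 f, T f & t = replace x f delta) is left redex
  then replace x (s2val (cid2 redex)) eps else t.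

Lemma redirect_instance T f :
  T f -> redirect T (replace x f delta) = replace x f eps.
Proof.
move=> Tf; rewrite /redirect; case: pselect => [redex|[]]; last by exists f.
by case: (cid2 redex) => g _ /= fg; rewrite (replace_inj delta_x fg).
Qed.

Lemma redirect_id T t :
  (forall f, T f -> t <> replace x f delta) -> redirect T t = t.
Proof.
move=> no_redex; rewrite /redirect; case: pselect => // redex.
by have [f /no_redex] := redex.
Qed.

Lemma redirect_equivalent T t : logically_equivalent l (redirect T t) t.
Proof.
have [[f Tf ->]|no_redex] := pselect (exists2 f, T f & t = replace x f delta).
  by rewrite redirect_instance //; apply: logically_equivalent_replace.
rewrite redirect_id; first exact: logically_equivalent_refl.
by move=> f Tf tE; apply: no_redex; exists f.
Qed.

Definition redirected_algebra T : algebra L :=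
  Algebra (fun c (a : 'I_(arity c) -> formula L) => redirect T (FApp a)).

Definition redirected_eval T v t : formula L :=
  @eval L (redirected_algebra T) v t.

Lemma redirected_eval_equivalent T v t :
  logically_equivalent l (redirected_eval T v t) (subst v t).
Proof.
elim: t => [y|c a IH]; first exact: logically_equivalent_refl.
apply: logically_equivalent_trans (redirect_equivalent T _) _.
exact: logically_equivalent_app.
Qed.

Lemma redirected_eval_app T v f c (a : 'I_(arity c) -> formula L) :
  (forall i, redirected_eval T v (replace x f (a i)) =
             replace x (redirected_eval T v f) (a i)) ->
  redirected_eval T v (replace x f (FApp a)) =
  redirect T (replace x (redirected_eval T v f) (FApp a)).
Proof. by rewrite /redirected_eval /= => /funext ->. Qed.

Hypothesis delta_notin_Q : forall f, ~ Q (replace x f delta).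

Lemma redirected_eval_replace T v f t :
  Var t `<=` [set x] -> subinstances_in Q x t ->
  redirected_eval T v (replace x f t) = replace x (redirected_eval T v f) t.
Proof.
elim: t => [y|c a IH] xt; first by rewrite /= (xt y erefl : y = x) eqxx.
move=> [Qt Qa]; rewrite redirected_eval_app => [|i].
  by apply: redirect_id => g _ tE; case: (@delta_notin_Q g); rewrite -tE.
by apply: IH (Qa i); apply: Var_arg_subset xt.
Qed.

Lemma redirected_eval_replace_proper T v f t :
  Var t `<=` [set x] -> proper_subinstances_in Q x t ->
  redirected_eval T v (replace x f t) =
  redirect T (replace x (redirected_eval T v f) t).
Proof.
case: t => // c a xa Qa; apply: redirected_eval_app => i.
by apply: redirected_eval_replace => //; apply: Var_arg_subset xa.
Qed.

Hypothesis Var_eps : Var eps `<=` [set x].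
Hypothesis Var_delta : Var delta `<=` [set x].
Hypothesis eps_neq_delta : forall f g, replace x f eps <> replace x g delta.
Hypothesis eps_proper : proper_subinstances_in Q x eps.
Hypothesis delta_proper : proper_subinstances_in Q x delta.

Lemma redirected_solutions T v :
  is_theory l T ->
  solutions x [set (eps, delta)]
    (redirected_eval T v : Fm L -> redirected_algebra T) = subst v @^-1` T.
Proof.
move=> thT; set ev := redirected_eval T v.
have ev_eps f : ev (replace x f eps) = replace x (ev f) eps.
  by rewrite /ev redirected_eval_replace_proper // redirect_id.
have ev_delta f : ev (replace x f delta) = redirect T (replace x (ev f) delta).
  by rewrite /ev redirected_eval_replace_proper.
apply/funext => f; apply/propext; rewrite /preimage /=.
rewrite -(logically_equivalent_theory thT (redirected_eval_equivalent T v f)).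
rewrite -/ev; split=> [|Tf _ [_ -> <-] /=].
  move=> /(_ _ (ex_intro2 _ _ _ erefl erefl)) /=; rewrite ev_eps ev_delta.
  move=> ev_eq; apply: contrapT => nTf.
  case: (@eps_neq_delta (ev f) (ev f)); rewrite ev_eq redirect_id // => g Tg.
  by move=> /(replace_inj delta_x) fg; rewrite fg in nTf.
by rewrite ev_eps ev_delta redirect_instance.
Qed.

Definition redirected_algebras (A : algebra L) : Prop :=
  exists2 T, is_theory l T & A = redirected_algebra T.

Lemma redirected_algebraic_semantics :
  algebraic_semantics l x [set (eps, delta)] redirected_algebras.
Proof.
apply: algebraic_semantics_theories => [_ [T thT ->] h hom_h|T thT].
  rewrite (_ : h = redirected_eval T (h \o FVar L)); last first.
    by apply/funext => f; apply: hom_eval.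
  by rewrite redirected_solutions //; apply: preimage_subst_theory.
exists (redirected_algebra T), (redirected_eval T (FVar L)).
  by split; [exists T|].
rewrite redirected_solutions //; apply/funext => f.
by rewrite /preimage /= subst_FVar.
Qed.

Lemma has_algebraic_semantics_redirected : has_algebraic_semantics l.
Proof.
exists x, [set (eps, delta)], redirected_algebras.
split; first by move=> _ -> z [/Var_eps|/Var_delta].
exact: redirected_algebraic_semantics.
Qed.

End RedirectedAlgebra.

(** * Formulas with recognisable instances *)

Lemma bigmax_ord_const (n m : nat) : 0 < n -> \max_(i < n) m = m.
Proof.
move=> n_gt0; apply/eqP; rewrite eqn_leq; apply/andP; split.
  exact/bigmax_leqP.
exact: (leq_bigmax (F := fun=> m) (Ordinal n_gt0)).
Qed.

Section Towers.
Variables (L : language) (c : conn L).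
Implicit Types (f t u : formula L) (n : nat).

Definition diag t : formula L := FApp (fun _ : 'I_(arity c) => t).

Definition tower n t : formula L := iter n diag t.

Lemma towerS n t : tower n.+1 t = diag (tower n t).
Proof. by []. Qed.

Lemma replace_tower n x f t : replace x f (tower n t) = tower n (replace x f t).
Proof. by elim: n => //= n ->. Qed.

Lemma logically_equivalent_diag (l : logic L) t u :
  logically_equivalent l t u -> logically_equivalent l (diag t) (diag u).
Proof. by move=> tu; apply: logically_equivalent_app. Qed.

Lemma logically_equivalent_tower (l : logic L) n t u :
  logically_equivalent l t u ->
  logically_equivalent l (tower n t) (tower n u).
Proof. by move=> tu; elim: n => //= n; apply: logically_equivalent_diag. Qed.

Lemma subinstances_in_tower (Q : set (formula L)) x n t :
  (forall f m, m < n -> Q (replace x f (tower m.+1 t))) ->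
  subinstances_in Q x t -> subinstances_in Q x (tower n t).
Proof.
move=> Q_tower Qt; elim: n Q_tower => // n IH Q_tower.
by split=> [f|_]; [apply: Q_tower|apply: IH => f m mn; apply/Q_tower/ltnW].
Qed.

Hypothesis arity_gt0 : 0 < arity c.

Lemma diag_inj : injective diag.
Proof. by move=> t u /FApp_inj_args /(_ (Ordinal arity_gt0)). Qed.

Lemma tower_inj n : injective (tower n).
Proof. by elim: n => //= n IH t u /diag_inj/IH. Qed.

Lemma depth_tower n t : depth (tower n t) = n + depth t.
Proof. by elim: n => //= n IH; rewrite bigmax_ord_const // IH. Qed.

Lemma Var_diag t : Var (diag t) = Var t.
Proof.
by apply/seteqP; split=> z /= => [[]//|zt]; exists (Ordinal arity_gt0).
Qed.

Lemma Var_tower n t : Var (tower n t) = Var t.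
Proof. by elim: n => // n <-; apply: Var_diag. Qed.

End Towers.

(* [w] and [w'] play the role of variables that no formula of small depth can
   imitate. *)
Lemma replace_inj_shallow (L : language) (x : var) (k : nat)
    (w w' t u : formula L) :
  (forall s, 0 < depth s < k -> replace x w s <> w') ->
  (forall s, 0 < depth s < k -> replace x w' s <> w) ->
  Var t `<=` [set x] -> Var u `<=` [set x] -> depth t < k -> depth u < k ->
  replace x w t = replace x w' u -> t = u.
Proof.
move=> w_neq w'_neq; elim: t u => [y|c a IH] [z|c' b] xt xu tk uk.
- by rewrite (xt y erefl : y = x) (xu z erefl : z = x).
- by rewrite [LHS]/= (xt y erefl : y = x) eqxx => /esym /w'_neq; case.
- by rewrite [RHS]/= (xu z erefl : z = x) eqxx => /w_neq; case.
move=> args_eq; have cc' := FApp_inj_conn args_eq; subst c'.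
congr FApp; apply/funext => i; apply: IH.
- exact: Var_arg_subset xt.
- exact: Var_arg_subset xu.
- exact: ltn_trans (depth_arg a i) tk.
- exact: ltn_trans (depth_arg b i) uk.
exact: FApp_inj_args args_eq i.
Qed.

Section Lead.
Variables (L : language) (p : conn L).
Implicit Types (f t : formula L).

Fixpoint lead t : nat :=
  match t with
  | FVar _ => 0
  | FApp c a => if `[< c = p >] then (\max_(i < arity c) lead (a i)).+1 else 0
  end.

Lemma lead_tower n t :
  0 < arity p -> lead (tower p n t) = n + lead t.
Proof.
by move=> p_gt0; elim: n => //= n IH; rewrite asboolT // bigmax_ord_const // IH.
Qed.

Lemma lead_diag_neq (q : conn L) t : p <> q -> lead (diag q t) = 0.
Proof. by move=> pq; rewrite /= asboolF // => qp; apply: pq. Qed.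

Lemma lead_replace x f t : lead (replace x f t) <= lead f + depth t.
Proof.
elim: t => [y|c a IH]; first by rewrite /=; case: eqP => //=; lia.
rewrite [replace _ _ _]/= [lead (FApp _)]/=; case: asboolP => // _.
rewrite /= addnS ltnS; apply/bigmax_leqP => i _.
by have := depth_arg a i; have := IH i; rewrite /=; lia.
Qed.

End Lead.

Section Gap.
Variables (L : language) (k : nat).
Implicit Types (f t : formula L).

(* Arguments of depth below [k] are ignored: only the depths of arguments that
   contain [x] remain close to each other when [x] becomes a deep formula. *)
Definition gap t : nat :=
  if t is FApp c a then
    \max_(i < arity c) \max_(j < arity c | k <= depth (a j))
      (depth (a i) - depth (a j))
  else 0.

Lemma gap_diag (c : conn L) t : gap (diag c t) = 0.
Proof. by rewrite /= big1 // => i _; rewrite big1 // => j _; apply: subnn. Qed.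

Lemma leq_gap (c : conn L) (a : 'I_(arity c) -> formula L) i j :
  k <= depth (a j) -> depth (a i) - depth (a j) <= gap (FApp a).
Proof.
by move=> kj; apply: (bigmax_sup i) => //; apply: (bigmax_sup j).
Qed.

Lemma gap_replace x f t : 0 < depth t <= k -> gap (replace x f t) <= k.
Proof.
case: t => // c a /andP[_ ak]; apply/bigmax_leqP => i _.
apply/bigmax_leqP => j; rewrite -!/(replace _ _ _) => kj.
have xj : Var (a j) x.
  apply: contrapT => /(replace_notin f) xj.
  by move: kj; rewrite xj leqNgt (leq_trans (depth_arg a j)).
have := depth_arg a i; have := depth_replace_ub x f (a i).
by have := depth_replace_lb f xj; lia.
Qed.

End Gap.

Section Words.
Variables (L : language) (p q : conn L).
Hypothesis p_neq_q : p <> q.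
Hypothesis p_gt0 : 0 < arity p.
Hypothesis q_gt0 : 0 < arity q.
Implicit Types (x : var) (f g s t : formula L) (k n : nat).

Definition word n t : formula L := tower p n (diag q t).

Lemma replace_word n x f t : replace x f (word n t) = word n (replace x f t).
Proof. by rewrite replace_tower. Qed.

Lemma replace_word_FVar n x f : replace x f (word n (FVar L x)) = word n f.
Proof. by rewrite replace_word /= eqxx. Qed.

Lemma word_inj n : injective (word n).
Proof. by move=> t u /(tower_inj p_gt0)/(diag_inj q_gt0). Qed.

Lemma Var_word n t : Var (word n t) = Var t.
Proof. by rewrite Var_tower // Var_diag. Qed.

Lemma lead_word n t : lead p (word n t) = n.
Proof. by rewrite lead_tower // lead_diag_neq // addn0. Qed.

Lemma replace_word_neq_word x k n f g s :
  0 < depth s <= n -> n <= k -> replace x (word k f) s <> word n g.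
Proof.
elim: s n => [//|c a IH] [//|n] /andP[_ an] nk.
move=> sw_eq; have cp := FApp_inj_conn sw_eq; subst c.
pose i := Ordinal p_gt0; have := FApp_inj_args sw_eq i.
have := depth_arg a i; have := IH i n; case: (a i) => [y|c b] /= IHi lt_ai.
  case: ifP => _; last by case: (n).
  by move=> /(congr1 (lead p)); rewrite !lead_word => kn; move: nk; lia.
by apply: IHi; [move: lt_ai an => /=; lia|apply: ltnW].
Qed.

Lemma subinstances_in_word x n N t : n <= N ->
  subinstances_in [set u | lead p u <= N] x t ->
  subinstances_in [set u | lead p u <= N] x (word n t).
Proof.
move=> nN Qt; apply: subinstances_in_tower => [f m mn|].
  by rewrite -/(word m.+1 t) replace_word /mkset lead_word (leq_trans mn nN).
by split=> // f; rewrite /mkset lead_diag_neq.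
Qed.

(* An instance of [padded x k (2 * k).+1 t] has more than [2 * k] leading [p]'s.
   Inside [t], of depth less than [k], the leading [p]'s that the instance of
   [x] might contribute are cut off at [k] by [q]. *)
Definition padded x k n t : formula L :=
  word n (replace x (word k (FVar L x)) t).

Lemma replace_padded x k n f t :
  replace x f (padded x k n t) = word n (replace x (word k f) t).
Proof. by rewrite replace_word replace_replace replace_word_FVar. Qed.

Lemma Var_padded x k n t :
  Var t `<=` [set x] -> Var (padded x k n t) `<=` [set x].
Proof.
by move=> xt; rewrite Var_word; apply: Var_replace_subset; rewrite ?Var_word.
Qed.

Lemma mem_Var_padded x k n t : Var t x -> Var (padded x k n t) x.
Proof.
move=> xt; rewrite Var_word; apply: (Var_replace_superset xt).
by rewrite Var_word.
Qed.

Lemma logically_equivalent_padded (l : logic L) x k n t u :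
  logically_equivalent l t u ->
  logically_equivalent l (padded x k n t) (padded x k n u).
Proof.
move=> tu; apply/logically_equivalent_tower/logically_equivalent_diag.
exact: logically_equivalent_replace.
Qed.

Lemma replace_padded_neq x k n f g t u :
  Var t `<=` [set x] -> Var u `<=` [set x] -> depth t < k -> depth u < k ->
  t <> u -> replace x f (padded x k n t) <> replace x g (padded x k n u).
Proof.
move=> xt xu tk uk tu; rewrite !replace_padded => /word_inj.
have separated f' g' s :
    0 < depth s < k -> replace x (word k f') s <> word k g'.
  by move=> /andP[s_gt0 /ltnW sk]; apply: replace_word_neq_word; rewrite ?s_gt0.
apply: contra_not tu.
by apply: (replace_inj_shallow (separated f g) (separated g f)).
Qed.

Lemma proper_subinstances_in_padded x k t : depth t < k ->
  proper_subinstances_in [set u | lead p u <= 2 * k] x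
    (padded x k (2 * k).+1 t).
Proof.
move=> tk /= _; apply: subinstances_in_word => //.
apply: (subinstances_in_replace (k := k)) => // [f s|].
  rewrite replace_word_FVar /mkset; have := lead_replace p x (word k f) s.
  by rewrite lead_word; lia.
by apply: subinstances_in_word => //; lia.
Qed.

End Words.

Section Lopsided.
Variables (L : language) (c : conn L).
Hypothesis arity_gt1 : 1 < arity c.
Implicit Types (x : var) (f g t u : formula L) (k : nat).

Let arity_gt0 : 0 < arity c := ltnW arity_gt1.
Let i0 : 'I_(arity c) := Ordinal arity_gt0.
Let i1 : 'I_(arity c) := Ordinal arity_gt1.

(* The tower in the first argument gives instances of [lopsided x k t] a gap
   above [k]; as it determines the formula put for [x], equal instances of
   [lopsided x k t] and [lopsided x k u] come from the same formula. *)
Definition lopsided_args x k t (i : 'I_(arity c)) : formula L :=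
  if val i == 0 then tower c (3 * k) (FVar L x)
  else replace x (tower c k (FVar L x)) t.

Definition lopsided x k t : formula L := FApp (lopsided_args x k t).

Lemma Var_lopsided x k t : Var t `<=` [set x] -> Var (lopsided x k t) = [set x].
Proof.
move=> xt; apply/seteqP; split=> [|z ->]; last first.
  by apply: (@Var_arg _ _ (lopsided_args x k t) i0); rewrite Var_tower.
suff sub_args i : Var (lopsided_args x k t i) `<=` [set x].
  by move=> z [i /sub_args].
rewrite /lopsided_args; case: ifP => _; first by rewrite Var_tower.
by apply: Var_replace_subset => //; rewrite Var_tower.
Qed.

Lemma logically_equivalent_lopsided (l : logic L) x k t u :
  logically_equivalent l t u ->
  logically_equivalent l (lopsided x k t) (lopsided x k u).
Proof.
move=> tu; apply: logically_equivalent_app => i; rewrite /lopsided_args.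
case: ifP => _; first exact: logically_equivalent_refl.
exact: logically_equivalent_replace.
Qed.

Lemma replace_lopsided_arg0 x k f t :
  replace x f (lopsided_args x k t i0) = tower c (3 * k) f.
Proof. by rewrite replace_tower /= eqxx. Qed.

Lemma replace_lopsided_arg1 x k f t :
  replace x f (lopsided_args x k t i1) = replace x (tower c k f) t.
Proof. by rewrite replace_replace replace_tower /= eqxx. Qed.

Lemma replace_tower_neq_tower x k f t :
  0 < depth t < k -> replace x (tower c k f) t <> tower c k f.
Proof.
case: t => // d a /andP[_ ak] fixed; have := depth_tower arity_gt0 k f.
have [[i xi]|xa] := pselect (Var (FApp a) x); last first.
  by rewrite -fixed replace_notin //; lia.
have := depth_arg (fun i => replace x (tower c k f) (a i)) i.
have := depth_replace_lb (tower c k f) xi.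
by rewrite -/(replace x _ (FApp a)) fixed; lia.
Qed.

Lemma replace_lopsided_neq x k f g t u :
  Var t `<=` [set x] -> Var u `<=` [set x] -> depth t < k -> depth u < k ->
  t <> u -> replace x f (lopsided x k t) <> replace x g (lopsided x k u).
Proof.
move=> xt xu tk uk tu app_eq.
have args_eq i : replace x f (lopsided_args x k t i) =
    replace x g (lopsided_args x k u i) by exact: FApp_inj_args app_eq i.
have := args_eq i0; rewrite !replace_lopsided_arg0 => /(tower_inj arity_gt0) fg.
have := args_eq i1; rewrite !replace_lopsided_arg1 fg; apply: contra_not tu.
have separated := @replace_tower_neq_tower x k g.
by apply: (replace_inj_shallow separated separated).
Qed.

Lemma gap_lopsided x k f t : Var t x -> depth t < k ->
  k < gap k (replace x f (lopsided x k t)).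
Proof.
move=> xt tk.
have := depth_replace_lb (tower c k f) xt.
have := depth_replace_ub x (tower c k f) t.
have := @leq_gap L k c (fun i => replace x f (lopsided_args x k t i)) i0 i1.
rewrite -[FApp _]/(replace x f (lopsided x k t)).
by rewrite replace_lopsided_arg0 replace_lopsided_arg1 !depth_tower //; lia.
Qed.

Lemma proper_subinstances_in_lopsided x k t : depth t < k ->
  proper_subinstances_in [set u | gap k u <= k] x (lopsided x k t).
Proof.
move=> tk i.
have small_gap n :
    subinstances_in [set u | gap k u <= k] x (tower c n (FVar L x)).
  apply: subinstances_in_tower => // f m _.
  by rewrite replace_tower towerS /mkset gap_diag.
rewrite /lopsided_args; case: ifP => // _.
apply: (subinstances_in_replace (k := k)) => // f s /andP[s_gt0 /ltnW sk].
by apply: gap_replace; rewrite s_gt0.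
Qed.

End Lopsided.

Section OneVariablePair.
Variables (L : language) (l : logic L) (phi psi : formula L) (x : var).
Hypothesis phi_neq_psi : phi <> psi.
Hypothesis phi_equiv_psi : logically_equivalent l phi psi.
Hypothesis Var_phi : Var phi `<=` [set x].
Hypothesis Var_psi : Var psi `<=` [set x].
Hypothesis x_in_psi : Var psi x.

Let k : nat := (maxn (depth phi) (depth psi)).+1.
Let depth_phi : depth phi < k. Proof. by rewrite ltnS leq_maxl. Qed.
Let depth_psi : depth psi < k. Proof. by rewrite ltnS leq_maxr. Qed.

Lemma algebraic_semantics_two_connectives (p q : conn L) :
  p <> q -> 0 < arity p -> 0 < arity q -> has_algebraic_semantics l.
Proof.
move=> pq p_gt0 q_gt0.
apply: (has_algebraic_semantics_redirected
          (eps := padded p q x k (2 * k).+1 phi)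
          (delta := padded p q x k (2 * k).+1 psi)
          (Q := [set u | lead p u <= 2 * k])).
- exact: logically_equivalent_padded.
- exact: mem_Var_padded.
- by move=> f; rewrite replace_padded /mkset lead_word // ltnn.
- exact: Var_padded.
- exact: Var_padded.
- by move=> f g; apply: replace_padded_neq.
- exact: proper_subinstances_in_padded.
- exact: proper_subinstances_in_padded.
Qed.

Lemma algebraic_semantics_multiary (c : conn L) :
  1 < arity c -> has_algebraic_semantics l.
Proof.
move=> c_gt1.
apply: (has_algebraic_semantics_redirected
          (eps := lopsided c x k phi) (delta := lopsided c x k psi)
          (Q := [set u | gap k u <= k])).
- exact: logically_equivalent_lopsided.
- by rewrite Var_lopsided.
- by move=> f; apply/negP; rewrite -ltnNge gap_lopsided.
- by rewrite Var_lopsided.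
- by rewrite Var_lopsided.
- by move=> f g; apply: replace_lopsided_neq.
- exact: proper_subinstances_in_lopsided.
- exact: proper_subinstances_in_lopsided.
Qed.

End OneVariablePair.

Lemma not_graph_based_conn (L : language) : ~ graph_based L ->
  (exists c : conn L, 1 < arity c) \/
  (exists p q : conn L, [/\ p <> q, 0 < arity p & 0 < arity q]).
Proof.
move=> not_graph; apply: contrapT => /not_orP[no_multiary no_pair].
apply: not_graph; split=> [c|p q p1 q1].
  by rewrite leqNgt; apply/negP => c_gt1; apply: no_multiary; exists c.
by apply: contrapT => pq; apply: no_pair; exists p, q; rewrite p1 q1.
Qed.

Theorem theorem6p2 (L : language) (l : logic L)
  (not_graph : ~ graph_based L)
  (phi psi : Fm L) (x : var)
  (phi_neq_psi : phi <> psi)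
  (phi_equiv_psi : logically_equivalent l phi psi)
  (vars_x : Var phi `|` Var psi = [set x]) :
  has_algebraic_semantics l.
Proof.
wlog x_in_psi : phi psi phi_neq_psi phi_equiv_psi vars_x / Var psi x.
  move=> swap; have [xphi|] : (Var phi `|` Var psi) x by rewrite vars_x.
    apply: (swap psi phi) => //; last by rewrite setUC.
      exact: nesym.
    exact: logically_equivalent_sym.
  exact: (swap phi psi).
have Var_phi : Var phi `<=` [set x] by rewrite -vars_x; apply: subsetUl.
have Var_psi : Var psi `<=` [set x] by rewrite -vars_x; apply: subsetUr.
have [[c c_gt1]|[p [q [pq p_gt0 q_gt0]]]] := not_graph_based_conn not_graph.
  exact: (algebraic_semantics_multiary phi_neq_psi phi_equiv_psi
            Var_phi Var_psi x_in_psi c_gt1).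
exact: (algebraic_semantics_two_connectives phi_neq_psi phi_equiv_psi
          Var_phi Var_psi x_in_psi pq p_gt0 q_gt0).
Qed.
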